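(* Let $L$ and $F$ be finite-dimensional coalgebras over $\mathbb{C}$, let $x: L\to \mathrm{Invd}(F)$ be a linear map, and let $y=x^t: F\to \mathrm{Invd}(L)$ be its transpose. Let $X(l)\in \mathrm{Invd}(T(F))$ ($l\in L$), $Y(f)\in\mathrm{Invd}(T(L))$ ($f\in F$), $\pi_x: T(L)\to \mathrm{Invd}(T(F))$ and $\pi_y: T(F)\to \mathrm{Invd}(T(L))$ be the associated operators and algebra morphisms. Then for all finite sequences $(l_1,\dots,l_p)$ of elements of $L$ and $(f_1,\dots,f_q)$ of elements of $F$, $$\langle X(l_1)\circ X(l_2)\circ\cdots\circ X(l_p),\ f_1\otimes f_2\otimes\cdots\otimes f_q\rangle = \langle Y(f_q)\circ Y(f_{q-1})\circ\cdots\circ Y(f_1),\ l_p\otimes l_{p-1}\otimes\cdots\otimes l_1\rangle .$$ More generally, for all $w\in T(L)$ and $v\in T(F)$, $$\langle \pi_x(w), v\rangle = \langle \pi_y(\tau(v)),\tau(w)\rangle .$$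
   Context: All coalgebras are coassociative with counit, over $\mathbb{C}$. For a coalgebra $C$ with coproduct $\Delta_C$ and counit $\epsilon_C$, $\mathrm{Invd}(C)$ denotes the algebra of right-invariant operators, i.e. the $A\in \mathrm{End}(C)$ with $\Delta_C\circ A=(A\otimes \mathrm{id})\circ\Delta_C$. For $A\in \mathrm{Invd}(C)$ and $c\in C$ put $\langle A,c\rangle=\epsilon_C(A(c))$; the map $A\mapsto \epsilon_C\circ A$ is a linear isomorphism $\mathrm{Invd}(C)\to C^*$, with inverse $\omega\mapsto(\omega\otimes \mathrm{id})\circ\Delta_C$. The transpose $y=x^t:F\to \mathrm{Invd}(L)$ of $x$ is the linear map determined by $\langle y(f),l\rangle=\langle x(l),f\rangle$ for all $l\in L$, $f\in F$. The tensor algebra $T(L)=\mathbb{C}\oplus L\oplus (L\otimes L)\oplus\cdots$ is a bialgebra whose coproduct $\Delta_L$ and counit $\epsilon_L$ are the unique unital algebra morphisms extending those of $L$; similarly $T(F)$ with $\Delta_F,\epsilon_F$. For $l\in L$, the operator $X(l)$ on $T(F)$ is determined by: $X(l)(1)=\epsilon_L(l)1$; $X(l)(f)=x(l)(f)$ for $f\in F$; and $X(l)(w_1w_2)=\sum_k X(l_k')(w_1)\,X(l_k'')(w_2)$ for $w_1,w_2\in T(F)$, where $\Delta_L(l)=\sum_k l_k'\otimes l_k''$. It is known that $X(l)\in \mathrm{Invd}(T(F))$. The map $\pi_x:T(L)\to \mathrm{Invd}(T(F))\subset \mathrm{End}(T(F))$ is the unital algebra morphism (product in the target is composition) with $\pi_x(l)=X(l)$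 for $l\in L$. The operators $Y(f)\in \mathrm{Invd}(T(L))$ and the morphism $\pi_y:T(F)\to \mathrm{Invd}(T(L))$ are defined in the same way from $y$, exchanging the roles of $L$ and $F$. On a tensor algebra $T(V)$, $\tau$ denotes the linear algebra anti-isomorphism reversing the order of tensors: $\tau(v_1\otimes\cdots\otimes v_n)=v_n\otimes\cdots\otimes v_1$, $\tau(1)=1$. *)

(* Defs.v *)
(* Mathematical Components, with the classical axioms of MathComp-Analysis. *)
From HB Require Import structures.
From mathcomp Require Import all_boot all_algebra.
From mathcomp Require Import boolp classical_sets functions reals complex.

Set Implicit Arguments.
Unset Strict Implicit.
Unset Printing Implicit Defensive.

Import GRing.Theory.
Local Open Scope ring_scope.

Section LinearMaps.
Variable K : fieldType.
Implicit Types U V W : lmodType K.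

Lemma linear_map0 U V (f : U -> V) : linear f -> f 0 = 0.
Proof. by move=> lf; have := lf (-1) 0 0; rewrite !scaleN1r !addNr. Qed.

Lemma linear_mapD U V (f : U -> V) : linear f -> {morph f : x y / x + y}.
Proof. by move=> lf x y; have := lf 1 x y; rewrite !scale1r. Qed.

Lemma linear_mapZ U V (f : U -> V) : linear f -> forall a x, f (a *: x) = a *: f x.
Proof. by move=> lf a x; have := lf a x 0; rewrite (linear_map0 lf) !addr0. Qed.

Lemma linear_map_id V : linear (@id V). Proof. by []. Qed.

Lemma linear_map_comp U V W (f : V -> W) (g : U -> V) :
  linear f -> linear g -> linear (fun u => f (g u)).
Proof. by move=> lf lg a u v /=; rewrite lg lf. Qed.

End LinearMaps.

(* The module [univ P] receiving the universal map satisfying [P]: formal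
   [K]-linear combinations of elements of [I], two of them being identified
   when every map [I -> U] satisfying [P], into any [K]-module [U], gives them
   the same value. Tensor products and tensor algebras are the instances
   where [P] is bilinearity and multilinearity. *)
Section UniversalModule.
Variables (K : fieldType) (I : choiceType).
Variable P : forall U : lmodType K, (I -> U) -> Prop.

Definition fsum_eval (U : lmodType K) (m : I -> U) (s : seq (K * I)) : U :=
  \sum_(p <- s) p.1 *: m p.2.

Definition fsum_eq : rel (seq (K * I)) := fun s t =>
  `[< forall (U : lmodType K) (m : I -> U), P m ->
        fsum_eval m s = fsum_eval m t >].

Lemma fsum_eq_equiv : equiv_class_of fsum_eq.
Proof.
split=> [s|s t|t s u].
- by apply/asboolP.
- by apply/asboolP/asboolP=> h U m /h ->.
- by move=> /asboolP h1 /asboolP h2; apply/asboolP=> U m hm; rewrite h1 ?h2.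
Qed.

Definition fsum_equiv_rel := EquivRelPack fsum_eq_equiv.

Definition univ : Type := {eq_quot fsum_equiv_rel}%qT.
HB.instance Definition _ := Choice.on univ.
HB.instance Definition _ := EqQuotient.on univ.

Implicit Types (s : seq (K * I)) (t u : univ).

Definition univ_lift (U : lmodType K) (m : I -> U) (t : univ) : U :=
  fsum_eval m (repr t).

Lemma univ_lift_pi (U : lmodType K) (m : I -> U) s :
  P m -> univ_lift m (\pi_univ s)%qT = fsum_eval m s.
Proof.
move=> hm; rewrite /univ_lift.
have /eqmodP/asboolP/(_ _ _ hm) // : (repr (\pi_univ s) = s %[mod univ])%qT.
by rewrite reprK.
Qed.

Lemma univ_sep t u :
  (forall (U : lmodType K) (m : I -> U), P m -> univ_lift m t = univ_lift m u) ->
  t = u.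
Proof.
by move=> h; rewrite -[t]reprK -[u]reprK; apply/eqmodP/asboolP => U m /h.
Qed.

Definition univ_gen (i : I) : univ := (\pi_univ [:: (1, i)])%qT.
Definition univ_zero : univ := (\pi_univ [::])%qT.
Definition univ_add t u : univ := (\pi_univ (repr t ++ repr u))%qT.
Definition univ_scale (c : K) t : univ :=
  (\pi_univ [seq (c * p.1, p.2) | p <- repr t])%qT.
Definition univ_opp t : univ := univ_scale (-1) t.

Section Lift.
Variables (U : lmodType K) (m : I -> U).
Hypothesis Pm : P m.

Lemma univ_lift_gen i : univ_lift m (univ_gen i) = m i.
Proof. by rewrite univ_lift_pi// /fsum_eval big_seq1 scale1r. Qed.

Lemma univ_lift_zero : univ_lift m univ_zero = 0.
Proof. by rewrite univ_lift_pi// /fsum_eval big_nil. Qed.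

Lemma univ_lift_add t u :
  univ_lift m (univ_add t u) = univ_lift m t + univ_lift m u.
Proof. by rewrite univ_lift_pi// /fsum_eval big_cat. Qed.

Lemma univ_lift_scale c t : univ_lift m (univ_scale c t) = c *: univ_lift m t.
Proof.
rewrite univ_lift_pi// /fsum_eval big_map scaler_sumr.
by apply: eq_bigr => p _; rewrite scalerA.
Qed.
End Lift.

Definition univ_liftE :=
  (univ_lift_gen, univ_lift_zero, univ_lift_add, univ_lift_scale).

Fact univ_addA : associative univ_add.
Proof. by move=> t u v; apply: univ_sep => U m hm; rewrite !univ_liftE// addrA. Qed.
Fact univ_addC : commutative univ_add.
Proof. by move=> t u; apply: univ_sep => U m hm; rewrite !univ_liftE// addrC. Qed.
Fact univ_add0 : left_id univ_zero univ_add.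
Proof. by move=> t; apply: univ_sep => U m hm; rewrite !univ_liftE// add0r. Qed.
Fact univ_addN : left_inverse univ_zero univ_opp univ_add.
Proof.
by move=> t; apply: univ_sep => U m hm; rewrite !univ_liftE// scaleN1r addNr.
Qed.
HB.instance Definition _ :=
  GRing.isZmodule.Build univ univ_addA univ_addC univ_add0 univ_addN.

Fact univ_scaleA a b t : univ_scale a (univ_scale b t) = univ_scale (a * b) t.
Proof. by apply: univ_sep => U m hm; rewrite !univ_liftE// scalerA. Qed.
Fact univ_scale1 : left_id 1 univ_scale.
Proof. by move=> t; apply: univ_sep => U m hm; rewrite !univ_liftE// scale1r. Qed.
Fact univ_scaleDr : right_distributive univ_scale +%R.
Proof.
by move=> a t u; apply: univ_sep => U m hm; rewrite !univ_liftE// scalerDr.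
Qed.
Fact univ_scaleDl t : {morph univ_scale^~ t : a b / a + b}.
Proof.
by move=> a b; apply: univ_sep => U m hm; rewrite !univ_liftE// scalerDl.
Qed.
HB.instance Definition _ := GRing.Zmodule_isLmodule.Build K univ
  univ_scaleA univ_scale1 univ_scaleDr univ_scaleDl.

Lemma univ_lift_linear (U : lmodType K) (m : I -> U) :
  P m -> linear (univ_lift m).
Proof. by move=> hm a t u; rewrite univ_lift_add// univ_lift_scale. Qed.

Lemma univ_lift_eq (U : lmodType K) (m m' : I -> U) :
  m =1 m' -> univ_lift m =1 univ_lift m'.
Proof. by move=> mm' t; apply: eq_bigr => p _; rewrite mm'. Qed.

Lemma univ_sum t : t = \sum_(p <- repr t) p.1 *: univ_gen p.2.
Proof.
apply: univ_sep => U m hm; rewrite {1}/univ_lift /fsum_eval.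
have lsum s : univ_lift m (\sum_(p <- s) p.1 *: univ_gen p.2) =
    \sum_(p <- s) p.1 *: m p.2.
  elim: s => [|p s ih]; first by rewrite !big_nil univ_lift_zero.
  by rewrite !big_cons univ_lift_linear// ih univ_lift_gen.
by rewrite lsum.
Qed.

Lemma univ_ext (U : lmodType K) (f g : univ -> U) : linear f -> linear g ->
  (forall i, f (univ_gen i) = g (univ_gen i)) -> f =1 g.
Proof.
move=> lf lg fg t; rewrite (univ_sum t).
elim: (X in \sum_(p <- X) _) => [|p s ih].
  by rewrite big_nil (linear_map0 lf) (linear_map0 lg).
by rewrite big_cons lf lg fg ih.
Qed.

End UniversalModule.

(* The same module together with its universal property, sealed so that its
   construction is not unfolded by unification. *)
Record universal_module (K : fieldType) (I : choiceType)
    (P : forall U : lmodType K, (I -> U) -> Prop) := UniversalModule {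
  um_sort : lmodType K;
  um_gen : I -> um_sort;
  um_lift : forall U : lmodType K, (I -> U) -> um_sort -> U;
  um_lift_linear : forall (U : lmodType K) (m : I -> U), P U m -> linear (um_lift m);
  um_lift_gen : forall (U : lmodType K) (m : I -> U) i,
    P U m -> um_lift m (um_gen i) = m i;
  um_sep : forall t u : um_sort,
    (forall (U : lmodType K) (m : I -> U), P U m -> um_lift m t = um_lift m u) ->
    t = u;
  um_ext : forall (U : lmodType K) (f g : um_sort -> U), linear f -> linear g ->
    (forall i, f (um_gen i) = g (um_gen i)) -> f =1 g;
  um_lift_eq : forall (U : lmodType K) (m m' : I -> U), m =1 m' -> um_lift m =1 um_lift m'
}.

Arguments um_sort {K I P} _.
Arguments um_gen {K I P} _ i.
Arguments um_lift {K I P} _ {U} m _.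

HB.lock Definition univ_module (K : fieldType) (I : choiceType)
    (P : forall U : lmodType K, (I -> U) -> Prop) : universal_module P :=
  @UniversalModule K I P (univ P) (univ_gen P) (@univ_lift K I P)
    (@univ_lift_linear K I P) (fun U m i Pm => univ_lift_gen Pm i)
    (@univ_sep K I P) (@univ_ext K I P) (@univ_lift_eq K I P).

Section TensorProduct.
Variables (K : fieldType) (V W : lmodType K).

Definition bilinear_map (U : lmodType K) (b : V -> W -> U) : Prop :=
  (forall w, linear (b^~ w)) /\ (forall v, linear (b v)).

Definition tens_module := @univ_module K (V * W)%type
  (fun U m => bilinear_map (fun v w => m (v, w))).
Definition tens : Type := um_sort tens_module.
HB.instance Definition _ := GRing.Lmodule.on tens.

Definition pure (v : V) (w : W) : tens := um_gen tens_module (v, w).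

(* [tlift b] sends [pure v w] to [b v w]; meaningful when [b] is bilinear. *)
Definition tlift (U : lmodType K) (b : V -> W -> U) (t : tens) : U :=
  um_lift tens_module (fun p => b p.1 p.2) t.

Lemma tlift_pure (U : lmodType K) (b : V -> W -> U) v w :
  bilinear_map b -> tlift b (pure v w) = b v w.
Proof. by move=> hb; rewrite /tlift um_lift_gen. Qed.

Lemma tlift_linear (U : lmodType K) (b : V -> W -> U) :
  bilinear_map b -> linear (tlift b).
Proof. by move=> hb; apply: um_lift_linear. Qed.

Lemma pure_bilinear : bilinear_map pure.
Proof.
split=> [w a v v'|v a w w']; apply: um_sep => U m hm;
  rewrite um_lift_linear// !um_lift_gen//.
- exact: hm.1.
- exact: hm.2.
Qed.

Lemma pure_linearl w : linear (fun v => pure v w).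
Proof. exact: pure_bilinear.1. Qed.

Lemma pure_linearr v : linear (pure v).
Proof. exact: pure_bilinear.2. Qed.

Lemma tens_ext (U : lmodType K) (f g : tens -> U) : linear f -> linear g ->
  (forall v w, f (pure v w) = g (pure v w)) -> f =1 g.
Proof. by move=> lf lg fg; apply: um_ext => // -[v w]; apply: fg. Qed.

End TensorProduct.

Arguments pure {K V W} v w.
Notation "V ⊗ W" := (tens V W) (at level 40, left associativity) : type_scope.

Section TensorMaps.
Variable K : fieldType.
Implicit Types U V W : lmodType K.

(* [f ⊗ g], meaningful when [f] and [g] are linear *)
Definition tmap V W V' W' (f : V -> V') (g : W -> W') : V ⊗ W -> V' ⊗ W' :=
  tlift (fun v w => pure (f v) (g w)).

Definition tassoc U V W : (U ⊗ V) ⊗ W -> U ⊗ (V ⊗ W) :=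
  tlift (fun t w => tlift (fun u v => pure u (pure v w)) t).

Lemma bilinear_comp V W V' W' U (b : V' -> W' -> U) (f : V -> V') (g : W -> W') :
  bilinear_map b -> linear f -> linear g -> bilinear_map (fun v w => b (f v) (g w)).
Proof. by move=> [b1 b2] lf lg; split=> [w|v] a u u' /=; rewrite ?lf ?lg ?b1 ?b2. Qed.

Lemma tmap_bilinear V W V' W' (f : V -> V') (g : W -> W') :
  linear f -> linear g -> bilinear_map (fun v w => pure (f v) (g w)).
Proof. by move=> lf lg; apply: (bilinear_comp (@pure_bilinear _ _ _)). Qed.

Lemma tmap_linear V W V' W' (f : V -> V') (g : W -> W') :
  linear f -> linear g -> linear (tmap f g).
Proof. by move=> lf lg; apply/tlift_linear/tmap_bilinear. Qed.

Lemma tmap_pure V W V' W' (f : V -> V') (g : W -> W') v w :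
  linear f -> linear g -> tmap f g (pure v w) = pure (f v) (g w).
Proof. by move=> lf lg; rewrite /tmap tlift_pure//; apply: tmap_bilinear. Qed.

Lemma tlift_bilinearl U V W W' (b : U -> V -> W -> W') :
  (forall u, bilinear_map (b u)) -> (forall v w, linear (fun u => b u v w)) ->
  forall t, linear (fun u => tlift (b u) t).
Proof.
move=> hb lb t a u u'; move: t.
apply: (@tens_ext _ _ _ _ (tlift (b (a *: u + u')))
  (fun t => a *: tlift (b u) t + tlift (b u') t)) => [|c t t'|v w].
- exact: tlift_linear.
- by rewrite !tlift_linear// !scalerDr !scalerA (mulrC c a) addrACA.
- by rewrite !tlift_pure// lb.
Qed.

Lemma tassoc_bil1 U V W w : bilinear_map (fun (u : U) (v : V) => pure u (pure v w : V ⊗ W)).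
Proof.
split=> [v|u] a x y; first by rewrite pure_linearl.
by rewrite pure_linearl pure_linearr.
Qed.

Lemma tassoc_bil U V W :
  bilinear_map (fun t w => tlift (fun u v => pure u (pure v w : V ⊗ W)) t : U ⊗ (V ⊗ W)).
Proof.
split=> [w|t]; first exact/tlift_linear/tassoc_bil1.
apply: tlift_bilinearl => [w|u v a w w']; first exact: tassoc_bil1.
by rewrite !pure_linearr.
Qed.

Lemma tassoc_linear U V W : linear (@tassoc U V W).
Proof. exact/tlift_linear/tassoc_bil. Qed.

Lemma tassoc_pure U V W (u : U) (v : V) (w : W) :
  tassoc (pure (pure u v) w) = pure u (pure v w).
Proof.
rewrite /tassoc tlift_pure; last exact: tassoc_bil.
by rewrite tlift_pure//; apply: tassoc_bil1.
Qed.

End TensorMaps.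

Lemma mul_bilinear (K : fieldType) (A : algType K) :
  bilinear_map (fun u v : A => u * v).
Proof.
by split=> w a u v; rewrite ?mulrDl ?mulrDr -?scalerAl -?scalerAr.
Qed.

Lemma linear_mull (K : fieldType) (U : lmodType K) (A : algType K) (f : U -> A) a :
  linear f -> linear (fun u => f u * a).
Proof. by move=> lf k u v; rewrite lf mulrDl -scalerAl. Qed.

Lemma linear_mulr (K : fieldType) (U : lmodType K) (A : algType K) (f : U -> A) a :
  linear f -> linear (fun u => a * f u).
Proof. by move=> lf k u v; rewrite lf mulrDr -scalerAr. Qed.

(* Over a field, [1] is detected by a linear form; hence the tensor product of
   two nonzero algebras is nonzero. *)
Lemma ex_linear_form (K : fieldType) (V : lmodType K) (v : V) :
  v != 0 -> exists2 phi : V -> K^o, linear phi & phi v = 1.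
Proof.
move=> v0.
pose lin (S : set V) := forall k u w, S u -> S w -> S (k *: u + w).
pose P (S : set V) := lin S /\ ~ S v.
have [F FP Ftot|M [[linM Mv] maxM]] := @Zorn_bigcup V P.
  split=> [k u w [A FA Au] [B FB Bw]|[A FA Av]]; last by have [_] := FP _ FA; apply.
  have [AB|BA] := Ftot _ _ FA FB.
  - by exists B => //; apply: (FP _ FB).1 => //; apply: AB.
  - by exists A => //; apply: (FP _ FA).1 => //; apply: BA.
pose M0 w := M w \/ w = 0.
have linM0 : lin M0.
  move=> k u w [Mu|->] [Mw|->]; rewrite ?scaler0 ?add0r ?addr0.
  - by left; apply: linM.
  - left; have := linM (k - 1) u u Mu Mu.
    by rewrite scalerBl scale1r subrK.
  - by left.
  - by right.
have M0v : ~ M0 v by move=> [//|v0']; rewrite v0' eqxx in v0.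
have M00 : M0 0 by right.
have M0Z k w : M0 w -> M0 (k *: w).
  by move=> hw; have := linM0 k _ _ hw M00; rewrite addr0.
have ex x : exists c : K, M0 (x - c *: v).
  have [Mx|nMx] := pselect (M x); first by exists 0; left; rewrite scale0r subr0.
  pose N : set V := [set u | exists k w, M0 w /\ u = k *: x + w]%classic.
  have [k [w [M0w vE]]] : N v.
    apply: contrapT => Nv; apply: (maxM N); last first.
      split=> // k _ _ [a [w [hw ->]]] [a' [w' [hw' ->]]].
      exists (k * a + a'), (k *: w + w'); split; first exact: linM0.
      by rewrite scalerDr scalerA scalerDl addrACA.
    split=> [u Mu|/(_ x)]; first by exists 0, u; split; [left|rewrite scale0r add0r].
    by move=> h; apply/nMx/h; exists 1, 0; rewrite scale1r addr0.
  have k0 : k != 0 by apply/eqP => k0; apply: M0v; rewrite vE k0 scale0r add0r.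
  exists k^-1; rewrite vE scalerDr scalerA mulVf// scale1r opprD addrA subrr.
  by rewrite add0r -scaleNr; apply: M0Z.
have uniq c : M0 (c *: v) -> c = 0.
  move=> h; apply/eqP; apply: contrapT => /negP c0; apply: M0v.
  by have := M0Z c^-1 _ h; rewrite scalerA mulVf// scale1r.
have {ex} [phi phiP] := choice ex.
have phiE x c : M0 (x - c *: v) -> phi x = c.
  move=> h; apply/eqP; rewrite -subr_eq0; apply/eqP/uniq.
  have := linM0 (-1) _ _ (phiP x) h.
  by rewrite scaleN1r opprB scalerBl addrA subrK.
exists phi => [k u w|]; apply: phiE.
- have := linM0 k _ _ (phiP u) (phiP w); rewrite scalerBr scalerA.
  by rewrite addrACA -opprD scalerDl.
- by rewrite scale1r subrr.
Qed.

Section TensorOfAlgebras.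
Variables (K : fieldType) (A B : algType K).
Implicit Types s t u : A ⊗ B.

Definition tens_mul s t : A ⊗ B :=
  tlift (fun a b => tlift (fun a' b' => pure (a * a') (b * b')) t) s.

Fact tens_mul_bil1 (a : A) (b : B) :
  bilinear_map (fun a' b' => pure (a * a') (b * b') : A ⊗ B).
Proof.
have [_ mr] := @mul_bilinear _ A; have [_ mr'] := @mul_bilinear _ B.
exact: tmap_bilinear.
Qed.

Fact tens_mul_bil2 t :
  bilinear_map (fun a b => tlift (fun a' b' => pure (a * a') (b * b') : A ⊗ B) t).
Proof.
have [ml _] := @mul_bilinear _ A; have [ml' _] := @mul_bilinear _ B.
split=> [b|a]; apply: tlift_bilinearl => [c|a' b' k c c'];
  try exact: tens_mul_bil1.
- by rewrite ml pure_linearl.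
- by rewrite ml' pure_linearr.
Qed.

Fact tens_mul_linearl t : linear (fun s => tens_mul s t).
Proof. exact/tlift_linear/tens_mul_bil2. Qed.

Fact tens_mul_linearr s : linear (tens_mul s).
Proof.
apply: tlift_bilinearl => [t|a b]; first exact: tens_mul_bil2.
exact/tlift_linear/tens_mul_bil1.
Qed.

Fact tens_mul_pure (a a' : A) (b b' : B) :
  tens_mul (pure a b) (pure a' b') = pure (a * a') (b * b').
Proof.
rewrite /tens_mul tlift_pure; last exact: tens_mul_bil2.
by rewrite tlift_pure//; exact: tens_mul_bil1.
Qed.

Fact tens_mulA : associative tens_mul.
Proof.
move=> s t u; move: s.
apply: (@tens_ext _ _ _ _ (fun s => tens_mul s (tens_mul t u))
                          (fun s => tens_mul (tens_mul s t) u)) => [||a b].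
- exact: tens_mul_linearl.
- exact: (linear_map_comp (tens_mul_linearl u) (tens_mul_linearl t)).
move: t; apply: (@tens_ext _ _ _ _ (fun t => tens_mul (pure a b) (tens_mul t u))
                       (fun t => tens_mul (tens_mul (pure a b) t) u)) => [||a' b'].
- exact: (linear_map_comp (tens_mul_linearr _) (tens_mul_linearl _)).
- exact: (linear_map_comp (tens_mul_linearl _) (tens_mul_linearr _)).
move: u; apply: (@tens_ext _ _ _ _ (fun u => tens_mul (pure a b) (tens_mul (pure a' b') u))
                       (tens_mul (tens_mul (pure a b) (pure a' b')))) => [||a2 b2].
- exact: (linear_map_comp (tens_mul_linearr _) (tens_mul_linearr _)).
- exact: tens_mul_linearr.
by rewrite !tens_mul_pure !mulrA.
Qed.

Fact tens_mul1 : left_id (pure 1 1) tens_mul.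
Proof.
apply: (@tens_ext _ _ _ _ (tens_mul (pure 1 1)) id) => [||a b].
- exact: tens_mul_linearr.
- exact: linear_map_id.
by rewrite tens_mul_pure !mul1r.
Qed.

Fact tens_mulr1 : right_id (pure 1 1) tens_mul.
Proof.
apply: (@tens_ext _ _ _ _ (fun t => tens_mul t (pure 1 1)) id) => [||a b].
- exact: tens_mul_linearl.
- exact: linear_map_id.
by rewrite tens_mul_pure !mulr1.
Qed.

Fact tens_mulDl : left_distributive tens_mul +%R.
Proof. by move=> s t u; exact: (linear_mapD (tens_mul_linearl u)). Qed.
Fact tens_mulDr : right_distributive tens_mul +%R.
Proof. by move=> s t u; exact: (linear_mapD (tens_mul_linearr s)). Qed.

HB.instance Definition _ := GRing.Zmodule_isPzRing.Build (A ⊗ B)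
  tens_mulA tens_mul1 tens_mulr1 tens_mulDl tens_mulDr.

Fact tens_scaleAl (c : K) s t : c *: (s * t) = (c *: s) * t.
Proof. by rewrite -[LHS](linear_mapZ (tens_mul_linearl t)). Qed.
Fact tens_scaleAr (c : K) s t : c *: (s * t) = s * (c *: t).
Proof. by rewrite -[LHS](linear_mapZ (tens_mul_linearr s)). Qed.

Fact tens_oner_neq0 : 1 != 0 :> A ⊗ B.
Proof.
have [f lf f1] := ex_linear_form (oner_neq0 A).
have [g lg g1] := ex_linear_form (oner_neq0 B).
have hb : bilinear_map (fun a b => f a * g b : K^o).
  exact: (bilinear_comp (@mul_bilinear _ K^o)).
apply/eqP => /(congr1 (tlift (fun a b => f a * g b : K^o))).
rewrite [1]/(pure 1 1) tlift_pure// f1 g1 mul1r (linear_map0 (tlift_linear hb)).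
by move/eqP; rewrite oner_eq0.
Qed.

HB.instance Definition _ := GRing.PzSemiRing_isNonZero.Build (A ⊗ B) tens_oner_neq0.
HB.instance Definition _ := GRing.Lmodule_isLalgebra.Build K (A ⊗ B) tens_scaleAl.
HB.instance Definition _ := GRing.Lalgebra_isAlgebra.Build K (A ⊗ B) tens_scaleAr.

Lemma pureM (a a' : A) (b b' : B) :
  pure a b * pure a' b' = pure (a * a') (b * b').
Proof. exact: tens_mul_pure. Qed.

End TensorOfAlgebras.

(* Tensor algebra: a linear map out of [T(V)], the direct sum of all tensor
   powers of [V], is a map on finite sequences that is linear in each entry. *)
Section TensorAlgebra.
Variables (K : fieldType) (V : lmodType K).

Definition multilinear_map (U : lmodType K) (m : seq V -> U) : Prop :=
  forall a b : seq V, linear (fun v => m (a ++ v :: b)).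

Definition talg_module := univ_module multilinear_map.
Definition talg : Type := um_sort talg_module.
HB.instance Definition _ := GRing.Lmodule.on talg.

(* [tword [:: v1; ..; vn]] is [v1 ⊗ .. ⊗ vn] *)
Definition tword (w : seq V) : talg := um_gen talg_module w.
Definition tgen (v : V) : talg := tword [:: v].

Definition talg_lift (U : lmodType K) (m : seq V -> U) : talg -> U := um_lift talg_module m.

Lemma talg_lift_word (U : lmodType K) (m : seq V -> U) w :
  multilinear_map m -> talg_lift m (tword w) = m w.
Proof. by move=> hm; rewrite /talg_lift um_lift_gen. Qed.

Lemma talg_lift_linear (U : lmodType K) (m : seq V -> U) :
  multilinear_map m -> linear (talg_lift m).
Proof. by move=> hm; apply: um_lift_linear. Qed.

Lemma talg_ext (U : lmodType K) (f g : talg -> U) : linear f -> linear g ->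
  (forall w, f (tword w) = g (tword w)) -> f =1 g.
Proof. by move=> lf lg fg; apply: um_ext. Qed.

Lemma tword_multilinear : multilinear_map tword.
Proof.
move=> a b k v v'; apply: um_sep => U m hm.
by rewrite um_lift_linear// !um_lift_gen// hm.
Qed.

Lemma tgen_linear : linear tgen.
Proof. exact: (tword_multilinear [::] [::]). Qed.

Definition talg_mul (t u : talg) : talg :=
  talg_lift (fun w => talg_lift (fun w' => tword (w ++ w')) u) t.

Fact talg_mul_mult1 w : multilinear_map (fun w' => tword (w ++ w')).
Proof. by move=> a b k v v'; rewrite !catA; apply: tword_multilinear. Qed.

Fact talg_lift_multilinear (U : lmodType K) (m : seq V -> seq V -> U) u :
  (forall w, multilinear_map (m w)) -> (forall w', multilinear_map (m^~ w')) ->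
  multilinear_map (fun w => talg_lift (m w) u).
Proof.
move=> h1 h2 a b k v v'; move: u.
apply: (@talg_ext _ (talg_lift (m (a ++ (k *: v + v') :: b)))
  (fun t => k *: talg_lift (m (a ++ v :: b)) t + talg_lift (m (a ++ v' :: b)) t))
  => [|c t t'|w].
- exact: talg_lift_linear.
- by rewrite !talg_lift_linear// !scalerDr !scalerA (mulrC c k) addrACA.
- by rewrite !talg_lift_word// h2.
Qed.

Fact talg_mul_mult2 u :
  multilinear_map (fun w => talg_lift (fun w' => tword (w ++ w')) u).
Proof.
apply: talg_lift_multilinear => [|w' a b k v v']; first exact: talg_mul_mult1.
by rewrite -!catA; apply: tword_multilinear.
Qed.

Fact talg_mul_linearl u : linear (fun t => talg_mul t u).
Proof. exact/talg_lift_linear/talg_mul_mult2. Qed.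

Fact talg_mul_linearr t : linear (talg_mul t).
Proof.
move=> k u u'; move: t.
apply: (@talg_ext _ (fun t => talg_mul t (k *: u + u'))
  (fun t => k *: talg_mul t u + talg_mul t u')) => [|c t t'|w].
- exact: talg_mul_linearl.
- by rewrite !talg_mul_linearl !scalerDr !scalerA (mulrC c k) addrACA.
- rewrite /talg_mul !talg_lift_word; try exact: talg_mul_mult2.
  by rewrite talg_lift_linear//; exact: talg_mul_mult1.
Qed.

Fact talg_mul_word w w' : talg_mul (tword w) (tword w') = tword (w ++ w').
Proof.
rewrite /talg_mul talg_lift_word; last exact: talg_mul_mult2.
by rewrite talg_lift_word//; exact: talg_mul_mult1.
Qed.

Fact talg_mulA : associative talg_mul.
Proof.
move=> s t u; move: s.
apply: (@talg_ext _ (fun s => talg_mul s (talg_mul t u))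
                    (fun s => talg_mul (talg_mul s t) u)) => [||w].
- exact: talg_mul_linearl.
- exact: (linear_map_comp (talg_mul_linearl u) (talg_mul_linearl t)).
move: t; apply: (@talg_ext _ (fun t => talg_mul (tword w) (talg_mul t u))
                       (fun t => talg_mul (talg_mul (tword w) t) u)) => [||w'].
- exact: (linear_map_comp (talg_mul_linearr _) (talg_mul_linearl _)).
- exact: (linear_map_comp (talg_mul_linearl _) (talg_mul_linearr _)).
move: u; apply: (@talg_ext _ (fun u => talg_mul (tword w) (talg_mul (tword w') u))
                       (talg_mul (talg_mul (tword w) (tword w')))) => [||w2].
- exact: (linear_map_comp (talg_mul_linearr _) (talg_mul_linearr _)).
- exact: talg_mul_linearr.
by rewrite !talg_mul_word !catA.
Qed.

Fact talg_mul1 : left_id (tword [::]) talg_mul.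
Proof.
apply: (@talg_ext _ (talg_mul (tword [::])) id) => [||w].
- exact: talg_mul_linearr.
- exact: linear_map_id.
by rewrite talg_mul_word.
Qed.

Fact talg_mulr1 : right_id (tword [::]) talg_mul.
Proof.
apply: (@talg_ext _ (fun t => talg_mul t (tword [::])) id) => [||w].
- exact: talg_mul_linearl.
- exact: linear_map_id.
by rewrite talg_mul_word cats0.
Qed.

Fact talg_mulDl : left_distributive talg_mul +%R.
Proof. by move=> s t u; exact: (linear_mapD (talg_mul_linearl u)). Qed.
Fact talg_mulDr : right_distributive talg_mul +%R.
Proof. by move=> s t u; exact: (linear_mapD (talg_mul_linearr s)). Qed.

HB.instance Definition _ := GRing.Zmodule_isPzRing.Build talg
  talg_mulA talg_mul1 talg_mulr1 talg_mulDl talg_mulDr.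

Fact talg_scaleAl (c : K) (s t : talg) : c *: (s * t) = (c *: s) * t.
Proof. by rewrite -[LHS](linear_mapZ (talg_mul_linearl t)). Qed.
Fact talg_scaleAr (c : K) (s t : talg) : c *: (s * t) = s * (c *: t).
Proof. by rewrite -[LHS](linear_mapZ (talg_mul_linearr s)). Qed.

Fact talg_oner_neq0 : 1 != 0 :> talg.
Proof.
pose m (w : seq V) : K^o := (w == [::])%:R.
have hm : multilinear_map m.
  by move=> a b k v v'; rewrite /m; case: a => [|? ?] /=; rewrite scaler0 addr0.
apply/eqP => /(congr1 (talg_lift m)).
rewrite [1]/(tword [::]) talg_lift_word// (linear_map0 (talg_lift_linear hm)).
by rewrite /m eqxx => /eqP; rewrite oner_eq0.
Qed.

HB.instance Definition _ := GRing.PzSemiRing_isNonZero.Build talg talg_oner_neq0.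
HB.instance Definition _ := GRing.Lmodule_isLalgebra.Build K talg talg_scaleAl.
HB.instance Definition _ := GRing.Lalgebra_isAlgebra.Build K talg talg_scaleAr.

Lemma tword_cat w w' : tword (w ++ w') = tword w * tword w'.
Proof. by rewrite -[LHS]talg_mul_word. Qed.

Lemma tword_nil : tword [::] = 1. Proof. by []. Qed.

Lemma tword_cons v w : tword (v :: w) = tgen v * tword w.
Proof. by rewrite -tword_cat. Qed.

Lemma twordE w : tword w = \prod_(v <- w) tgen v.
Proof. by elim: w => [|v w ih]; rewrite ?big_nil// big_cons -ih tword_cons. Qed.

(* The unital algebra morphism extending a linear map [phi : V -> A] *)
Section AlgebraLift.
Variables (A : algType K) (phi : V -> A).

Definition talg_mor : talg -> A := talg_lift (fun w => \prod_(v <- w) phi v).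

Hypothesis lphi : linear phi.

Fact talg_mor_mult : multilinear_map (fun w => \prod_(v <- w) phi v).
Proof.
move=> a b k v v'; rewrite !big_cat /= !big_cons lphi.
by rewrite mulrDl mulrDr -scalerAl -scalerAr.
Qed.

Lemma talg_mor_word w : talg_mor (tword w) = \prod_(v <- w) phi v.
Proof. by rewrite /talg_mor talg_lift_word//; exact: talg_mor_mult. Qed.

Lemma talg_mor_linear : linear talg_mor.
Proof. exact/talg_lift_linear/talg_mor_mult. Qed.

Lemma talg_mor_gen v : talg_mor (tgen v) = phi v.
Proof. by rewrite talg_mor_word big_seq1. Qed.

Lemma talg_mor1 : talg_mor 1 = 1.
Proof. by rewrite -tword_nil talg_mor_word big_nil. Qed.

Lemma talg_morM : {morph talg_mor : t u / t * u}.
Proof.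
have [ml mr] := @mul_bilinear _ A; have lm := talg_mor_linear.
move=> t u; move: t; apply: (@talg_ext _ (fun t => talg_mor (t * u))
   (fun t => talg_mor t * talg_mor u)) => [||w].
- exact: (linear_map_comp lm (talg_mul_linearl u)).
- exact: (linear_map_comp (ml _) lm).
move: u; apply: (@talg_ext _ (fun u => talg_mor (tword w * u))
   (fun u => talg_mor (tword w) * talg_mor u)) => [||w'].
- exact: (linear_map_comp lm (talg_mul_linearr _)).
- exact: (linear_map_comp (mr _) lm).
by rewrite -tword_cat !talg_mor_word big_cat.
Qed.

End AlgebraLift.

Lemma talg_mor_ext (A : algType K) (f g : talg -> A) :
    linear f -> linear g -> f 1 = 1 -> g 1 = 1 ->
    {morph f : t u / t * u} -> {morph g : t u / t * u} ->
  (forall v, f (tgen v) = g (tgen v)) -> f =1 g.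
Proof.
move=> lf lg f1 g1 fM gM fg; apply: talg_ext => //.
by elim=> [|v w ih]; rewrite ?tword_nil ?f1// tword_cons fM gM fg ih.
Qed.

Definition trev : talg -> talg := talg_lift (fun w => tword (rev w)).

Fact trev_mult : multilinear_map (fun w => tword (rev w)).
Proof.
by move=> a b k v v'; rewrite !rev_cat !rev_cons -!cats1 -!catA; exact: tword_multilinear.
Qed.

Lemma trev_word w : trev (tword w) = tword (rev w).
Proof. by rewrite /trev talg_lift_word//; exact: trev_mult. Qed.

Lemma trev_linear : linear trev.
Proof. exact/talg_lift_linear/trev_mult. Qed.

End TensorAlgebra.

Section TensorMapTheory.
Variable K : fieldType.

Lemma eq_tlift (V W U : lmodType K) (b b' : V -> W -> U) t :
  b =2 b' -> tlift b t = tlift b' t.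
Proof. by move=> bb'; apply: um_lift_eq => -[v w]; rewrite /= bb'. Qed.

Lemma tlift_comp (V W U U' : lmodType K) (b : V -> W -> U) (f : U -> U') t :
  bilinear_map b -> linear f -> f (tlift b t) = tlift (fun v w => f (b v w)) t.
Proof.
move=> hb lf; have hfb : bilinear_map (fun v w => f (b v w)).
  split=> [w|v]; apply: (linear_map_comp lf); [exact: hb.1|exact: hb.2].
move: t; apply: (@tens_ext _ _ _ _ (fun t => f (tlift b t))) => [||v w].
- exact: (linear_map_comp lf (tlift_linear hb)).
- exact: tlift_linear.
- by rewrite !tlift_pure.
Qed.

Lemma tlift_tmap (V W V' W' U : lmodType K) (b : V' -> W' -> U)
    (f : V -> V') (g : W -> W') t :
  bilinear_map b -> linear f -> linear g ->
  tlift b (tmap f g t) = tlift (fun v w => b (f v) (g w)) t.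
Proof.
move=> hb lf lg; rewrite /tmap (tlift_comp _ (tmap_bilinear lf lg) (tlift_linear hb)).
by apply: eq_tlift => v w; rewrite tlift_pure.
Qed.

Lemma tmap_comp (V W V' W' V2 W2 : lmodType K) (f : V -> V') (g : W -> W')
    (f' : V' -> V2) (g' : W' -> W2) t :
  linear f -> linear g -> linear f' -> linear g' ->
  tmap f' g' (tmap f g t) = tmap (fun v => f' (f v)) (fun w => g' (g w)) t.
Proof.
by move=> lf lg lf' lg'; rewrite {1}/tmap tlift_tmap//; exact: tmap_bilinear.
Qed.

Lemma tmap_id (V W : lmodType K) (t : V ⊗ W) : tmap id id t = t.
Proof.
move: t; apply: (@tens_ext _ _ _ _ (tmap id id) id) => [||v w].
- by apply: tmap_linear; exact: linear_map_id.
- exact: linear_map_id.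
- by rewrite tmap_pure//; exact: linear_map_id.
Qed.

Lemma eq_tmap (V W V' W' : lmodType K) (f f' : V -> V') (g g' : W -> W') t :
  f =1 f' -> g =1 g' -> tmap f g t = tmap f' g' t.
Proof. by move=> ff' gg'; apply: eq_tlift => v w; rewrite ff' gg'. Qed.

Lemma tassoc_tmap (U V W U' V' W' : lmodType K) (f : U -> U') (g : V -> V')
    (h : W -> W') t : linear f -> linear g -> linear h ->
  tassoc (tmap (tmap f g) h t) = tmap f (tmap g h) (tassoc t).
Proof.
move=> lf lg lh; have lfg := tmap_linear lf lg; have lgh := tmap_linear lg lh.
move: t; apply: (@tens_ext _ _ _ _ (fun t => tassoc (tmap (tmap f g) h t))
   (fun t => tmap f (tmap g h) (tassoc t))) => [||t w].
- exact: (linear_map_comp (@tassoc_linear _ _ _ _) (tmap_linear lfg lh)).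
- exact: (linear_map_comp (tmap_linear lf lgh) (@tassoc_linear _ _ _ _)).
rewrite tmap_pure//; move: t.
apply: (@tens_ext _ _ _ _ (fun t => tassoc (pure (tmap f g t) (h w)))
   (fun t => tmap f (tmap g h) (tassoc (pure t w)))) => [||u v].
- apply: (linear_map_comp (@tassoc_linear _ _ _ _)).
  exact: (linear_map_comp (@pure_linearl _ _ _ _) lfg).
- apply: (linear_map_comp (tmap_linear lf lgh)).
  exact: (linear_map_comp (@tassoc_linear _ _ _ _) (@pure_linearl _ _ _ _)).
by rewrite tmap_pure// !tassoc_pure !tmap_pure.
Qed.

Lemma tens_morM (A B D : algType K) (f : A ⊗ B -> D) : linear f ->
  (forall a a' b b', f (pure (a * a') (b * b')) = f (pure a b) * f (pure a' b')) ->
  {morph f : s t / s * t}.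
Proof.
move=> lf fM s t; have [ml mr] := @mul_bilinear _ D.
move: s; apply: (@tens_ext _ _ _ _ (fun s => f (s * t)) (fun s => f s * f t)) => [||a b].
- exact: (linear_map_comp lf (tens_mul_linearl _)).
- exact: (linear_map_comp (ml _) lf).
move: t; apply: (@tens_ext _ _ _ _ (fun t => f (pure a b * t))
  (fun t => f (pure a b) * f t)) => [||a' b'].
- exact: (linear_map_comp lf (tens_mul_linearr _)).
- exact: (linear_map_comp (mr _) lf).
by rewrite pureM fM.
Qed.

Lemma tmapM (A B A' B' : algType K) (f : A -> A') (g : B -> B') :
  linear f -> linear g -> {morph f : a b / a * b} -> {morph g : a b / a * b} ->
  {morph tmap f g : s t / s * t}.
Proof.
move=> lf lg fM gM; apply: tens_morM => [|a a' b b']; first exact: tmap_linear.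
by rewrite !tmap_pure// fM gM pureM.
Qed.

Lemma tassocM (A B D : algType K) : {morph @tassoc K A B D : s t / s * t}.
Proof.
apply: tens_morM => [|s s' d d']; first exact: tassoc_linear.
have lt (d0 : D) : linear (fun s : A ⊗ B => tassoc (pure s d0)).
  exact: (linear_map_comp (@tassoc_linear _ _ _ _) (@pure_linearl _ _ _ _)).
move: s; apply: (@tens_ext _ _ _ _ (fun s => tassoc (pure (s * s') (d * d')))
   (fun s => tassoc (pure s d) * tassoc (pure s' d'))) => [||a b].
- exact: (linear_map_comp (lt _) (tens_mul_linearl _)).
- exact: linear_mull.
move: s'; apply: (@tens_ext _ _ _ _ (fun s' => tassoc (pure (pure a b * s') (d * d')))
   (fun s' => tassoc (pure (pure a b) d) * tassoc (pure s' d'))) => [||a' b'].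
- exact: (linear_map_comp (lt _) (tens_mul_linearr _)).
- exact: linear_mulr.
by rewrite pureM !tassoc_pure !pureM.
Qed.

End TensorMapTheory.

HB.mixin Record isCoalgebra (K : fieldType) C of GRing.Lmodule K C := {
  comul : C -> C ⊗ C;
  counit : C -> K;
  comul_linear : linear comul;
  counit_scalar : scalar counit;
  comulA : forall c, tassoc (tmap comul id (comul c)) = tmap id comul (comul c);
  counitl : forall c, tlift (fun a b => counit a *: b) (comul c) = c;
  counitr : forall c, tlift (fun a b => counit b *: a) (comul c) = c
}.

#[short(type="coalgType")]
HB.structure Definition Coalgebra (K : fieldType) :=
  {C of isCoalgebra K C & GRing.Lmodule K C}.

#[short(type="finCoalgType")]
HB.structure Definition FinCoalgebra (K : fieldType) :=
  {C of Coalgebra K C & Vector K C}.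

Lemma counit_linear (K : fieldType) (C : coalgType K) : linear (@counit K C : C -> K^o).
Proof. exact: counit_scalar. Qed.

Lemma scale_bilinear (K : fieldType) (U V : lmodType K) (f : U -> K) :
  scalar f -> bilinear_map (fun u (v : V) => f u *: v).
Proof.
move=> lf; split=> [v|u] a x y; first by rewrite lf scalerDl scalerA.
by rewrite scalerDr !scalerA mulrC.
Qed.

Lemma scale_bilinearr (K : fieldType) (U V : lmodType K) (f : U -> K) :
  scalar f -> bilinear_map (fun (v : V) u => f u *: v).
Proof. by move=> lf; have [h1 h2] := scale_bilinear V lf; split. Qed.

Section TensorBialgebra.
Variables (K : fieldType) (C : coalgType K).

Definition talg_comul : talg C -> talg C ⊗ talg C :=
  talg_mor (fun c => tmap (@tgen K C) (@tgen K C) (comul c)).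
Definition talg_counit : talg C -> K := talg_mor (@counit K C : C -> K^o).

Let lgen := @tgen_linear K C.
Let lcop := @comul_linear K C.
Let lcou := @counit_scalar K C.

Fact talg_comul_gen_linear :
  linear (fun c : C => tmap (@tgen K C) (@tgen K C) (comul c)).
Proof. by apply: linear_map_comp lcop; exact: tmap_linear. Qed.

Lemma talg_comul_linear : linear talg_comul.
Proof. exact/talg_mor_linear/talg_comul_gen_linear. Qed.

Lemma talg_counit_scalar : scalar talg_counit.
Proof. exact/(@talg_mor_linear _ _ K^o)/counit_linear. Qed.

Lemma talg_comul1 : talg_comul 1 = 1.
Proof. exact/talg_mor1/talg_comul_gen_linear. Qed.

Lemma talg_comulM : {morph talg_comul : s t / s * t}.
Proof. exact/talg_morM/talg_comul_gen_linear. Qed.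

Lemma talg_comul_gen c : talg_comul (tgen c) = tmap (@tgen K C) (@tgen K C) (comul c).
Proof. exact/talg_mor_gen/talg_comul_gen_linear. Qed.

Lemma talg_counit1 : talg_counit 1 = 1.
Proof. exact/(@talg_mor1 _ _ K^o)/counit_linear. Qed.

Lemma talg_counitM : {morph talg_counit : s t / s * t}.
Proof. exact/(@talg_morM _ _ K^o)/counit_linear. Qed.

Lemma talg_counit_gen c : talg_counit (tgen c) = counit c.
Proof. exact/(@talg_mor_gen _ _ K^o)/counit_linear. Qed.

Let ld := talg_comul_linear.
Let le := talg_counit_scalar.
Let lid := @linear_map_id K (talg C).

Fact talg_comulA t :
  tassoc (tmap talg_comul id (talg_comul t)) = tmap id talg_comul (talg_comul t).
Proof.
have la := @tassoc_linear K (talg C) (talg C) (talg C).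
have ldi := tmap_linear ld lid; have lidd := tmap_linear lid ld.
move: t; apply: (@talg_mor_ext _ _ _
  (fun t => tassoc (tmap talg_comul id (talg_comul t)))
  (fun t => tmap id talg_comul (talg_comul t))) => [||||s t|s t|c].
- exact: (linear_map_comp la (linear_map_comp ldi ld)).
- exact: (linear_map_comp lidd ld).
- by rewrite talg_comul1 tmap_pure// talg_comul1 tassoc_pure.
- by rewrite talg_comul1 tmap_pure// talg_comul1.
- by rewrite talg_comulM (tmapM ld lid talg_comulM)// tassocM.
- by rewrite talg_comulM (tmapM lid ld _ talg_comulM).
have lic := @linear_map_id K C; have lgg := tmap_linear lgen lgen.
rewrite talg_comul_gen !tmap_comp//.
rewrite (@eq_tmap _ _ _ _ _ _ (fun c => tmap (@tgen K C) (@tgen K C) (comul c))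
   _ (fun c => tgen (id c)))//; last exact: talg_comul_gen.
rewrite -(tmap_comp _ lcop lic lgg lgen) tassoc_tmap// comulA tmap_comp//.
by apply: eq_tmap => // d; rewrite talg_comul_gen.
Qed.

Fact talg_counitl t :
  tlift (fun a b => talg_counit a *: b) (talg_comul t) = t.
Proof.
have hb := scale_bilinear (talg C) le; have lb := tlift_linear hb.
move: t; apply: (@talg_mor_ext _ _ _
  (fun t => tlift (fun a b => talg_counit a *: b) (talg_comul t)) id) => [||||s t||c].
- exact: (linear_map_comp lb ld).
- exact: lid.
- by rewrite talg_comul1 tlift_pure// talg_counit1 scale1r.
- by [].
- rewrite talg_comulM tens_morM// => a a' b b'.
  by rewrite !tlift_pure// talg_counitM -scalerAl -scalerAr scalerA.
- by [].
rewrite talg_comul_gen tlift_tmap// -[in RHS](counitl c).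
rewrite (tlift_comp _ (scale_bilinear _ lcou) lgen).
by apply: eq_tlift => a b; rewrite talg_counit_gen (linear_mapZ lgen).
Qed.

Fact talg_counitr t :
  tlift (fun a b => talg_counit b *: a) (talg_comul t) = t.
Proof.
have hb := scale_bilinearr (talg C) le; have lb := tlift_linear hb.
move: t; apply: (@talg_mor_ext _ _ _
  (fun t => tlift (fun a b => talg_counit b *: a) (talg_comul t)) id) => [||||s t||c].
- exact: (linear_map_comp lb ld).
- exact: lid.
- by rewrite talg_comul1 tlift_pure// talg_counit1 scale1r.
- by [].
- rewrite talg_comulM tens_morM// => a a' b b'.
  by rewrite !tlift_pure// talg_counitM -scalerAl -scalerAr scalerA.
- by [].
rewrite talg_comul_gen tlift_tmap// -[in RHS](counitr c).
rewrite (tlift_comp _ (scale_bilinearr _ lcou) lgen).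
by apply: eq_tlift => a b; rewrite talg_counit_gen (linear_mapZ lgen).
Qed.

HB.instance Definition _ := isCoalgebra.Build K (talg C)
  talg_comul_linear talg_counit_scalar talg_comulA talg_counitl talg_counitr.

End TensorBialgebra.

(* Right-invariant operators, with composition as product *)
Section InvariantOperators.
Variables (K : fieldType) (C : coalgType K).

Definition right_invariant (A : C -> C) : Prop :=
  linear A /\ forall c, comul (A c) = tmap A id (comul c).

Definition invd_pred : {pred C -> C} := fun A => `[< right_invariant A >].

Record invd := Invd { invd_fun :> C -> C; _ : invd_fun \in invd_pred }.
HB.instance Definition _ := [isSub for invd_fun].
HB.instance Definition _ := [Choice of invd by <:].

Lemma invd_right_invariant (A : invd) : right_invariant A.
Proof. by case: A => A hA; apply/asboolP. Qed.

Lemma invd_linear (A : invd) : linear A.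
Proof. exact: (invd_right_invariant A).1. Qed.

Lemma invd_comul (A : invd) c : comul (A c) = tmap A id (comul c).
Proof. exact: (invd_right_invariant A).2. Qed.

Lemma invd_eq (A B : invd) : A =1 B -> A = B.
Proof. by move=> AB; apply/val_inj/funext. Qed.

Fact invd_submod_closed : subsemimod_closed invd_pred.
Proof.
have lc := @comul_linear K C; have lid := @linear_map_id K C.
have l0 : linear (fun _ : C => 0 : C) by move=> a u v; rewrite scaler0 addr0.
split; first split.
- apply/asboolP; split => // c; rewrite (linear_map0 lc).
  move: (comul c); apply: (@tens_ext _ _ _ _ (fun=> 0)) => [a u v||v w].
  + by rewrite scaler0 addr0.
  + exact: (@tmap_linear _ _ _ _ _ (fun=> 0)).
  + rewrite (@tmap_pure _ _ _ _ _ (fun=> 0))//.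
    by rewrite (linear_map0 (@pure_linearl _ C C w)).
- move=> A B /asboolP[lA hA] /asboolP[lB hB]; apply/asboolP.
  have lAB : linear (A + B).
    by move=> a u v; rewrite !fctE lA lB scalerDr addrACA.
  split=> // c; rewrite (linear_mapD lc) hA hB; move: (comul c).
  apply: (@tens_ext _ _ _ _ (fun t => tmap A id t + tmap B id t)) => [a u v||v w].
  + by rewrite !(tmap_linear _ lid)// scalerDr addrACA.
  + exact: tmap_linear.
  + by rewrite !tmap_pure// (linear_mapD (@pure_linearl _ C C w)).
- move=> k A /asboolP[lA hA]; apply/asboolP.
  have lkA : linear (k *: A).
    by move=> a u v; rewrite !fctE lA scalerDr !scalerA (mulrC k).
  split=> // c; rewrite (linear_mapZ lc) hA; move: (comul c).
  apply: (@tens_ext _ _ _ _ (fun t => k *: tmap A id t)) => [a u v||v w].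
  + by rewrite !(tmap_linear _ lid)// scalerDr !scalerA (mulrC k).
  + exact: tmap_linear.
  + by rewrite !tmap_pure// (linear_mapZ (@pure_linearl _ C C w)).
Qed.

HB.instance Definition _ :=
  GRing.SubChoice_isSubLmodule.Build K (C -> C) invd_pred invd invd_submod_closed.

Fact invd_one_subproof : id \in invd_pred.
Proof. by apply/asboolP; split => [|c]; [exact: linear_map_id|rewrite tmap_id]. Qed.
Definition invd_one : invd := Invd invd_one_subproof.

Fact invd_mul_subproof (A B : invd) : A \o B \in invd_pred.
Proof.
have [[lA lB] lid] := (invd_linear A, invd_linear B, @linear_map_id K C).
apply/asboolP; split=> [|c]; first exact: linear_map_comp.
by rewrite /= !invd_comul tmap_comp.
Qed.
Definition invd_mul (A B : invd) : invd := @Invd (A \o B) (@invd_mul_subproof A B).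

Fact invd_mulA : associative invd_mul.
Proof. by move=> A B D; apply: invd_eq. Qed.
Fact invd_mul1 : left_id invd_one invd_mul.
Proof. by move=> A; apply: invd_eq. Qed.
Fact invd_mulr1 : right_id invd_one invd_mul.
Proof. by move=> A; apply: invd_eq. Qed.
Fact invd_mulDl : left_distributive invd_mul +%R.
Proof. by move=> A B D; apply: invd_eq. Qed.
Fact invd_mulDr : right_distributive invd_mul +%R.
Proof. by move=> A B D; apply: invd_eq => c; exact: (linear_mapD (invd_linear A)). Qed.

HB.instance Definition _ := GRing.Zmodule_isPzRing.Build invd
  invd_mulA invd_mul1 invd_mulr1 invd_mulDl invd_mulDr.

Lemma invdM (A B : invd) c : (A * B) c = A (B c). Proof. by []. Qed.
Lemma invd1 c : (1 : invd) c = c. Proof. by []. Qed.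
Lemma invdD (A B : invd) c : (A + B) c = A c + B c. Proof. by []. Qed.
Lemma invdZ (k : K) (A : invd) c : (k *: A) c = k *: A c. Proof. by []. Qed.

Fact invd_scaleAl (k : K) (A B : invd) : k *: (A * B) = (k *: A) * B.
Proof. exact: invd_eq. Qed.
Fact invd_scaleAr (k : K) (A B : invd) : k *: (A * B) = A * (k *: B).
Proof.
by apply: invd_eq => c; rewrite invdM !invdZ invdM (linear_mapZ (invd_linear A)).
Qed.

Definition pairing (A : invd) (c : C) : K := counit (A c).

Lemma pairing_scalarl c : scalar (pairing^~ c).
Proof. by move=> k A B; rewrite /pairing invdD invdZ counit_scalar. Qed.

Lemma pairing_scalarr A : scalar (pairing A).
Proof. by move=> k c d; rewrite /pairing invd_linear counit_scalar. Qed.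

(* [A = (ω ⊗ id) ∘ Δ] for [ω = ε ∘ A] *)
Lemma invdE (A : invd) c : A c = tlift (fun a b => pairing A a *: b) (comul c).
Proof.
rewrite -[LHS]counitl invd_comul.
apply: tlift_tmap (@invd_linear A) (@linear_map_id K C).
exact/scale_bilinear/counit_scalar.
Qed.

Lemma pairing_inj (A B : invd) : (forall c, pairing A c = pairing B c) -> A = B.
Proof.
by move=> AB; apply: invd_eq => c; rewrite !invdE; apply: eq_tlift => a b; rewrite AB.
Qed.

(* [ω ↦ (ω ⊗ id) ∘ Δ], the inverse of [A ↦ ε ∘ A] *)
Section OfForm.
Variables (omega : C -> K).
Hypothesis lo : scalar omega.

Fact invd_of_subproof :
  (fun c => tlift (fun a b => omega a *: b) (comul c)) \in invd_pred.
Proof.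
have hb := scale_bilinear C lo; have lb := tlift_linear hb.
have lc := @comul_linear K C; have lid := @linear_map_id K C.
set A := fun c => _; have lA : linear A by exact: (linear_map_comp lb lc).
have hb2 := scale_bilinear (C ⊗ C) lo; have lb2 := tlift_linear hb2.
apply/asboolP; split => // c; rewrite /A (tlift_comp _ hb lc).
rewrite (_ : tlift _ _ =
    tlift (fun a b : C => omega a *: comul (id b)) (comul c)); last first.
  by apply: eq_tlift => a b; rewrite (linear_mapZ lc).
rewrite -(tlift_tmap _ hb2 lid lc) -comulA; move: (comul c).
apply: (@tens_ext _ _ _ _ (fun t =>
  tlift (fun a b => omega a *: b) (tassoc (tmap comul id t)))) => [||a b].
- apply: (linear_map_comp lb2).
  exact: (linear_map_comp (@tassoc_linear _ _ _ _) (tmap_linear lc lid)).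
- exact: tmap_linear.
rewrite !tmap_pure// /A; move: (comul a).
apply: (@tens_ext _ _ _ _ (fun t =>
  tlift (fun a b => omega a *: b) (tassoc (pure t b)))
  (fun t => pure (tlift (fun a b => omega a *: b) t) b)) => [||x y].
- apply: (linear_map_comp lb2).
  exact: (linear_map_comp (@tassoc_linear _ _ _ _) (@pure_linearl _ _ _ _)).
- exact: (linear_map_comp (@pure_linearl _ _ _ _) lb).
by rewrite tassoc_pure !tlift_pure// (linear_mapZ (@pure_linearl _ _ _ _)).
Qed.

Definition invd_of : invd := Invd invd_of_subproof.

Lemma pairing_invd_of c : pairing invd_of c = omega c.
Proof.
have [lo' le] : linear (omega : C -> K^o) * linear (@counit K C : C -> K^o).
  by split; [exact: lo | exact: counit_linear].
rewrite /pairing /= [LHS](tlift_comp _ (scale_bilinear C lo) le) -[in RHS](counitr c).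
rewrite [RHS](tlift_comp _ (scale_bilinearr C (@counit_scalar K C)) lo').
apply: (@eq_tlift _ _ _ K^o) => a b; rewrite [LHS](linear_mapZ le) [RHS](linear_mapZ lo').
exact: mulrC.
Qed.

End OfForm.
End InvariantOperators.

Notation "⟪ A , c ⟫" := (pairing A c) (format "⟪ A ,  c ⟫") : ring_scope.

(* [invd C] is a zero ring when [C] is zero; it is an [algType] for [T(C)]. *)
Section InvdTensorAlgebra.
Variables (K : fieldType) (C : coalgType K).

Fact invd_talg_oner_neq0 : 1 != 0 :> invd (talg C).
Proof.
apply/eqP => /(congr1 (fun A : invd (talg C) => A 1)) /eqP.
by rewrite invd1 (oner_eq0 (talg C)).
Qed.

HB.instance Definition _ :=
  GRing.PzSemiRing_isNonZero.Build (invd (talg C)) invd_talg_oner_neq0.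
HB.instance Definition _ :=
  GRing.Lmodule_isLalgebra.Build K (invd (talg C)) (@invd_scaleAl K (talg C)).
HB.instance Definition _ :=
  GRing.Lalgebra_isAlgebra.Build K (invd (talg C)) (@invd_scaleAr K (talg C)).

End InvdTensorAlgebra.

Section Extension.
Variables (K : fieldType) (L F : coalgType K) (x : {linear L -> invd F}).

Let lx : linear x := linearP x.
Let lxf f : linear (fun l => x l f).
Proof. by move=> k a b; rewrite lx. Qed.
Let lcop := @comul_linear K L.
Let lcou := @counit_scalar K L.

(* [X(l)] on [f1 ⊗ .. ⊗ fn] is the sum of the [x(l')(f1) ⊗ .. ⊗ x(l'..')(fn)]
   over the [n]-fold coproduct of [l]. *)
Fixpoint ext_word (w : seq F) (l : L) : talg F :=
  if w is f :: w' then tlift (fun l' l'' => tgen (x l' f) * ext_word w' l'') (comul l)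
  else counit l *: 1.

Definition ext_fun (l : L) : talg F -> talg F := talg_lift (fun w => ext_word w l).

Fact ext_word_bil f w :
  linear (ext_word w) -> bilinear_map (fun l' l'' => tgen (x l' f) * ext_word w l'').
Proof.
move=> lw; split=> [l''|l'].
- apply: linear_mull; exact: (linear_map_comp (@tgen_linear K F) (lxf f)).
- exact: linear_mulr.
Qed.

Fact ext_word_linear w : linear (ext_word w).
Proof.
elim: w => [|f w ih] /=.
- by move=> k a b; rewrite lcou scalerDl scalerA.
- exact: (linear_map_comp (tlift_linear (ext_word_bil f ih)) lcop).
Qed.

Let hbw f w := ext_word_bil f (ext_word_linear w).

Fact ext_word_multilinear l : multilinear_map (fun w => ext_word w l).
Proof.
move=> a b; elim: a l => [|f a ih] l /=.
- apply: tlift_bilinearl => [f|l' l'']; first exact: hbw.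
  by apply: linear_mull; exact: (linear_map_comp (@tgen_linear K F) (@invd_linear _ _ _)).
- apply: tlift_bilinearl => [f'|l' l'']; first exact: hbw.
  exact: linear_mulr.
Qed.

Lemma ext_fun_word l w : ext_fun l (tword w) = ext_word w l.
Proof. by rewrite /ext_fun talg_lift_word//; exact: ext_word_multilinear. Qed.

Lemma ext_fun_linear l : linear (ext_fun l).
Proof. exact/talg_lift_linear/ext_word_multilinear. Qed.

Lemma ext_fun_linearl w : linear (fun l => ext_fun l w).
Proof.
move=> k a b; move: w; apply: (@talg_ext _ _ _ (ext_fun (k *: a + b))
   (fun w => k *: ext_fun a w + ext_fun b w)) => [|c t u|w].
- exact: ext_fun_linear.
- by rewrite !ext_fun_linear !scalerDr !scalerA (mulrC c k) addrACA.
- by rewrite !ext_fun_word ext_word_linear.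
Qed.

Lemma ext_fun1 l : ext_fun l 1 = counit l *: 1.
Proof. by rewrite -tword_nil ext_fun_word. Qed.

Lemma ext_fun_gen l f : ext_fun l (tgen f) = tgen (x l f).
Proof.
rewrite ext_fun_word /= -[in RHS](counitr l).
have lg : linear (fun l => tgen (x l f)).
  exact: (linear_map_comp (@tgen_linear K F) (lxf f)).
rewrite (tlift_comp _ (scale_bilinearr _ lcou) lg).
by apply: eq_tlift => a b; rewrite (linear_mapZ lg) -scalerAr mulr1.
Qed.

Fact ext_fun_bil w1 w2 : bilinear_map (fun l' l'' => ext_fun l' w1 * ext_fun l'' w2).
Proof.
by split=> l; [apply: linear_mull|apply: linear_mulr]; exact: ext_fun_linearl.
Qed.

Lemma ext_funM l w1 w2 :
  ext_fun l (w1 * w2) = tlift (fun l' l'' => ext_fun l' w1 * ext_fun l'' w2) (comul l).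
Proof.
have lid := @linear_map_id K L.
move: w1; apply: (@talg_ext _ _ _ (fun w1 => ext_fun l (w1 * w2)) (fun w1 =>
  tlift (fun l' l'' => ext_fun l' w1 * ext_fun l'' w2) (comul l))) => [||w1].
- exact: (linear_map_comp (ext_fun_linear l) (linear_mull w2 (@linear_map_id K _))).
- apply: tlift_bilinearl => [w1|l' l'']; first exact: ext_fun_bil.
  exact/linear_mull/ext_fun_linear.
move: w2; apply: (@talg_ext _ _ _ (fun w2 => ext_fun l (tword w1 * w2)) (fun w2 =>
  tlift (fun l' l'' => ext_fun l' (tword w1) * ext_fun l'' w2) (comul l))) => [||w2].
- exact: (linear_map_comp (ext_fun_linear l) (linear_mulr _ (@linear_map_id K _))).
- apply: tlift_bilinearl => [w|l' l'']; first exact: ext_fun_bil.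
  exact/linear_mulr/ext_fun_linear.
rewrite -tword_cat ext_fun_word.
elim: w1 l => [|f w1 ih] l /=.
  have lw := ext_word_linear w2.
  rewrite -[in LHS](counitl l) (tlift_comp _ (scale_bilinear _ lcou) lw).
  apply: eq_tlift => a b.
  by rewrite tword_nil ext_fun1 -scalerAl mul1r (linear_mapZ lw) ext_fun_word.
pose G a (s : L ⊗ L) := tgen (x a f) *
  tlift (fun b c => ext_word w1 b * ext_word w2 c) s.
have hb : bilinear_map (fun b c => ext_word w1 b * ext_word w2 c).
  by split=> c; [apply: linear_mull|apply: linear_mulr]; exact: ext_word_linear.
have lG : bilinear_map G.
  split=> [s|a].
  - apply: linear_mull; exact: (linear_map_comp (@tgen_linear K F) (lxf f)).
  - exact/linear_mulr/tlift_linear.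
transitivity (tlift G (tmap id comul (comul l))).
  rewrite tlift_tmap//; apply: eq_tlift => a b; rewrite ih; congr (_ * _).
  by apply: eq_tlift => c d; rewrite !ext_fun_word.
rewrite -comulA; set R := RHS.
have -> : R = tlift (fun a b => tlift (fun c d => tgen (x c f) * ext_word w1 d) a
    * ext_word w2 b) (tmap comul id (comul l)).
  rewrite tlift_tmap//.
  - by apply: eq_tlift => a b; rewrite !ext_fun_word.
  - split=> [b|a]; first by apply: linear_mull; exact/tlift_linear/hbw.
    exact/linear_mulr/ext_word_linear.
move: (tmap comul id _).
have hb2 : bilinear_map (fun (a : L ⊗ L) b =>
    tlift (fun c d => tgen (x c f) * ext_word w1 d) a * ext_word w2 b).
  split=> [b|a]; first by apply: linear_mull; exact/tlift_linear/hbw.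
  exact/linear_mulr/ext_word_linear.
apply: (@tens_ext _ _ _ _ (fun t => tlift G (tassoc t))) => [||s c].
- exact: (linear_map_comp (tlift_linear lG) (@tassoc_linear _ _ _ _)).
- exact: tlift_linear.
rewrite tlift_pure//; move: s; apply: (@tens_ext _ _ _ _
  (fun s => tlift G (tassoc (pure s c)))
  (fun s => tlift (fun c d => tgen (x c f) * ext_word w1 d) s * ext_word w2 c))
  => [||a b].
- apply: (linear_map_comp (tlift_linear lG)).
  exact: (linear_map_comp (@tassoc_linear _ _ _ _) (@pure_linearl _ _ _ _)).
- exact/linear_mull/tlift_linear/hbw.
by rewrite tassoc_pure !tlift_pure// /G tlift_pure// mulrA.
Qed.

Fact ext_invd_subproof l : ext_fun l \in @invd_pred K (talg F).
Proof.
have lid := @linear_map_id K (talg F); have ld := @talg_comul_linear K F.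
have lX := ext_fun_linear; have lXi m := tmap_linear (lX m) lid.
have lXl (t : talg F ⊗ talg F) : linear (fun l => tmap (ext_fun l) id t).
  move=> k a b; move: t; apply: (@tens_ext _ _ _ _
    (tmap (ext_fun (k *: a + b)) id)
    (fun t => k *: tmap (ext_fun a) id t + tmap (ext_fun b) id t)) => [|c s t|u v].
  - exact: lXi.
  - by rewrite !lXi !scalerDr !scalerA (mulrC c k) addrACA.
  - by rewrite !tmap_pure// ext_fun_linearl pure_linearl.
have XM (m : L) (s t : talg F ⊗ talg F) : tmap (ext_fun m) id (s * t) =
    tlift (fun a b => tmap (ext_fun a) id s * tmap (ext_fun b) id t) (comul m).
  have hb (s' t' : talg F ⊗ talg F) : bilinear_map (fun a b =>
      tmap (ext_fun a) id s' * tmap (ext_fun b) id t').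
    by split=> c; [apply: linear_mull|apply: linear_mulr]; exact: lXl.
  move: s; apply: (@tens_ext _ _ _ _ (fun s => tmap (ext_fun m) id (s * t)) (fun s =>
    tlift (fun a b => tmap (ext_fun a) id s * tmap (ext_fun b) id t) (comul m)))
    => [||u v].
  - exact: (linear_map_comp (lXi m) (linear_mull t (@linear_map_id K _))).
  - by apply: tlift_bilinearl => // a b; exact/linear_mull.
  move: t; apply: (@tens_ext _ _ _ _ (fun t => tmap (ext_fun m) id (pure u v * t))
    (fun t => tlift (fun a b => tmap (ext_fun a) id (pure u v) *
      tmap (ext_fun b) id t) (comul m))) => [||u' v'].
  - exact: (linear_map_comp (lXi m) (linear_mulr _ (@linear_map_id K _))).
  - by apply: tlift_bilinearl => // a b; exact/linear_mulr.
  have lp := @pure_linearl K (talg F) (talg F) (v * v').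
  rewrite pureM tmap_pure// ext_funM (tlift_comp _ (ext_fun_bil u u') lp).
  by apply: eq_tlift => a b; rewrite !tmap_pure// pureM.
apply/asboolP; split=> // w; rewrite /comul /=.
move: w; apply: (@talg_ext _ _ _ (fun w => talg_comul (ext_fun l w))
   (fun w => tmap (ext_fun l) id (talg_comul w))) => [||w].
- exact: (linear_map_comp ld (lX l)).
- exact: (linear_map_comp (lXi l) ld).
elim: w l => [|f w ih] l.
  rewrite tword_nil ext_fun1 (linear_mapZ ld) talg_comul1 [1]/(pure 1 1) tmap_pure//.
  by rewrite ext_fun1 (linear_mapZ (@pure_linearl K _ _ _)).
rewrite tword_cons talg_comulM XM ext_funM (tlift_comp _ (ext_fun_bil _ _) ld).
apply: eq_tlift => a b; rewrite talg_comulM ih; congr (_ * _).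
have [[lg lf] lxa] := (@tgen_linear K F, @linear_map_id K F, @invd_linear _ _ (x a)).
rewrite ext_fun_gen !talg_comul_gen invd_comul !tmap_comp//.
by apply: eq_tmap => // f'; rewrite ext_fun_gen.
Qed.

(* The operator [X(l)], characterized by [ext_op1], [ext_op_gen], [ext_opM] *)
Definition ext_op (l : L) : invd (talg F) := Invd (ext_invd_subproof l).

Lemma ext_op_linear : linear ext_op.
Proof. by move=> k a b; apply: invd_eq => w; exact: ext_fun_linearl. Qed.

Lemma ext_op1 l : ext_op l 1 = counit l *: 1.
Proof. exact: ext_fun1. Qed.

Lemma ext_op_gen l f : ext_op l (tgen f) = tgen (x l f).
Proof. exact: ext_fun_gen. Qed.

Lemma ext_opM l w1 w2 :
  ext_op l (w1 * w2) = tlift (fun l' l'' => ext_op l' w1 * ext_op l'' w2) (comul l).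
Proof. exact: ext_funM. Qed.

Lemma ext_op_unique (Z : L -> talg F -> talg F) :
  (forall l, linear (Z l)) -> (forall l, Z l 1 = counit l *: 1) ->
  (forall l f, Z l (tgen f) = tgen (x l f)) ->
  (forall l w1 w2,
    Z l (w1 * w2) = tlift (fun l' l'' => Z l' w1 * Z l'' w2) (comul l)) ->
  forall l, Z l =1 ext_op l.
Proof.
move=> lZ Z1 Zg ZM l; apply: talg_ext => // [|w]; first exact: ext_fun_linear.
elim: w l => [|f w ih] l; first by rewrite tword_nil Z1 ext_op1.
by rewrite tword_cons ZM ext_opM; apply: eq_tlift => a b; rewrite Zg ih ext_op_gen.
Qed.

(* The unital algebra morphism with [pi_mor (tgen l) = ext_op l] *)
Definition pi_mor : talg L -> invd (talg F) := talg_mor ext_op.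

Lemma pi_mor_linear : linear pi_mor.
Proof. exact/talg_mor_linear/ext_op_linear. Qed.

Lemma pi_mor1 : pi_mor 1 = 1.
Proof. exact/talg_mor1/ext_op_linear. Qed.

Lemma pi_morM : {morph pi_mor : s t / s * t}.
Proof. exact/talg_morM/ext_op_linear. Qed.

Lemma pi_mor_gen l : pi_mor (tgen l) = ext_op l.
Proof. exact/talg_mor_gen/ext_op_linear. Qed.

Fact transpose_form_scalar f : scalar (fun l => ⟪x l, f⟫).
Proof. by move=> k a b; rewrite linearP pairing_scalarl. Qed.

(* [x^t], characterized by [transposeP] and [pairing_inj] *)
Definition transpose (f : F) : invd L := invd_of (transpose_form_scalar f).

Lemma transposeP l f : ⟪transpose f, l⟫ = ⟪x l, f⟫.
Proof. exact: pairing_invd_of. Qed.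

Fact transpose_linear : linear transpose.
Proof.
move=> k f g; apply: pairing_inj => l.
by rewrite pairing_scalarl !transposeP pairing_scalarr.
Qed.
HB.instance Definition _ :=
  GRing.isLinear.Build K F (invd L) *:%R transpose transpose_linear.

End Extension.

(* Main.v *)
(* The form [B(w, v) = ⟪pi_x(w), v⟫] on [T(L) × T(F)] is determined by its values
   on [L × F] together with [B(w, v1 v2) = Σ B(w', v1) B(w'', v2)] (the operators
   [X(l)] act on products through the coproduct) and
   [B(w1 w2, v) = Σ B(w2, v') B(w1, v'')] (right invariance).  Since [τ] reverses
   products and preserves coproducts, these rules are exchanged by
   [(w, v) ↦ (τ(v), τ(w))], so [⟪pi_y(τ(v)), τ(w)⟫] obeys the same rules; it has
   the same values on [L × F] by definition of the transpose. *)
Require Import Defs.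
From mathcomp Require Import all_boot all_algebra reals complex.

Set Implicit Arguments.
Unset Strict Implicit.
Unset Printing Implicit Defensive.

Import GRing.Theory.
Local Open Scope ring_scope.

Section TensorOfAlgebrasTheory.
Variable K : fieldType.

(** The outer expansion runs over the right factor: in an induction on words this is the coproduct
    of the tail, which the induction hypothesis produces first. *)
Lemma tlift_mul (A B : algType K) (U : lmodType K) (g : A -> B -> U) (s t : A ⊗ B) :
  bilinear_map g ->
  tlift g (s * t) = tlift (fun a b => tlift (fun a' b' => g (a' * a) (b' * b)) s) t.
Proof.
move=> hg; have lg := tlift_linear hg.
have [mlA mrA] := @mul_bilinear _ A; have [mlB mrB] := @mul_bilinear _ B.
have hl a b : bilinear_map (fun a' b' => g (a' * a) (b' * b)).
  exact: bilinear_comp hg (mlA a) (mlB b).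
have hr a' b' : bilinear_map (fun a b => g (a' * a) (b' * b)).
  exact: bilinear_comp hg (mrA a') (mrB b').
have hs s' : bilinear_map (fun a b => tlift (fun a' b' => g (a' * a) (b' * b)) s').
  split=> [b|a]; apply: tlift_bilinearl => // a' b'.
  - exact: (hr a' b').1.
  - exact: (hr a' b').2.
move: s; apply: (@tens_ext _ _ _ _ (fun s => tlift g (s * t))
  (fun s => tlift (fun a b => tlift (fun a' b' => g (a' * a) (b' * b)) s) t))
  => [||a' b'].
- exact: (linear_map_comp lg (tens_mul_linearl t)).
- by apply: tlift_bilinearl => // a b; exact: tlift_linear.
move: t; apply: (@tens_ext _ _ _ _ (fun t => tlift g (pure a' b' * t))) => [||a b].
- exact: (linear_map_comp lg (tens_mul_linearr _)).
- exact: tlift_linear.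
by rewrite pureM !tlift_pure.
Qed.

Lemma tmap_antiM (A B A' B' : algType K) (f : A -> A') (g : B -> B') :
  linear f -> linear g ->
  (forall a b, f (a * b) = f b * f a) -> (forall a b, g (a * b) = g b * g a) ->
  forall s t, tmap f g (s * t) = tmap f g t * tmap f g s.
Proof.
move=> lf lg fM gM s t; have lfg := tmap_linear lf lg.
move: s; apply: (@tens_ext _ _ _ _ (fun s => tmap f g (s * t))
  (fun s => tmap f g t * tmap f g s)) => [||a b].
- exact: (linear_map_comp lfg (tens_mul_linearl t)).
- exact: (linear_map_comp (tens_mul_linearr _) lfg).
move: t; apply: (@tens_ext _ _ _ _ (fun t => tmap f g (pure a b * t))
  (fun t => tmap f g t * tmap f g (pure a b))) => [||a' b'].
- exact: (linear_map_comp lfg (tens_mul_linearr _)).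
- exact: (linear_map_comp (tens_mul_linearl _) lfg).
by rewrite !pureM !tmap_pure// !pureM fM gM.
Qed.

End TensorOfAlgebrasTheory.

Lemma trevM (K : fieldType) (V : lmodType K) (s t : talg V) :
  trev (s * t) = trev t * trev s.
Proof.
have lr := @trev_linear K V; have [ml mr] := @mul_bilinear K (talg V).
move: s; apply: (@talg_ext _ _ _ (fun s => trev (s * t))
  (fun s => trev t * trev s)) => [||v].
- exact: (linear_map_comp lr (ml t)).
- exact: (linear_map_comp (mr _) lr).
move: t; apply: (@talg_ext _ _ _ (fun t => trev (tword v * t))
  (fun t => trev t * trev (tword v))) => [||w].
- exact: (linear_map_comp lr (mr _)).
- exact: (linear_map_comp (ml _) lr).
by rewrite -tword_cat !trev_word rev_cat tword_cat.
Qed.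

Lemma trev1 (K : fieldType) (V : lmodType K) : trev (1 : talg V) = 1.
Proof. by rewrite -tword_nil trev_word. Qed.

Lemma trev_gen (K : fieldType) (V : lmodType K) (v : V) : trev (tgen v) = tgen v.
Proof. by rewrite trev_word. Qed.

Section ReversalCoalgebra.
Variables (K : fieldType) (C : coalgType K).
Let lr := @trev_linear K C.

Lemma talg_counit_trev (t : talg C) : talg_counit (trev t) = talg_counit t.
Proof.
have le : linear (@talg_counit K C : talg C -> K^o) := @talg_counit_scalar K C.
move: t; apply: (@talg_ext _ _ K^o) => // [|w].
  exact: linear_map_comp le lr.
elim: w => [|c w ih]; first by rewrite tword_nil trev1.
by rewrite tword_cons trevM !talg_counitM ih trev_gen mulrC.
Qed.

(** Both sides reverse products and agree on letters, which [trev] fixes. The two legs are not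
    swapped, because the product of [talg C ⊗ talg C] is componentwise. *)
Lemma talg_comul_trev (t : talg C) :
  talg_comul (trev t) = tmap (@trev K C) (@trev K C) (talg_comul t).
Proof.
have ld := @talg_comul_linear K C; have lrr := tmap_linear lr lr.
move: t; apply: talg_ext => [||w].
- exact: linear_map_comp ld lr.
- exact: linear_map_comp lrr ld.
elim: w => [|c w ih].
  by rewrite tword_nil trev1 talg_comul1 [1]/(pure 1 1) tmap_pure// trev1.
have lg := @tgen_linear K C.
rewrite tword_cons trevM !talg_comulM ih trev_gen.
rewrite tmap_antiM//; try exact: trevM.
congr (_ * _); rewrite talg_comul_gen tmap_comp//.
by apply: eq_tmap => d; rewrite trev_gen.
Qed.

End ReversalCoalgebra.

Section SkewPairing.
Variable K : fieldType.

(** Products on either side are dual to coproducts on the other, with the order reversed in [skewMl]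
    only. Values lie in [K^o], the scalars seen as a module, so that [tlift] applies. *)
Record skew_pairing (L F : coalgType K) (B : talg L -> talg F -> K^o) : Prop := {
  skew_bilinear : bilinear_map B;
  skew1l : forall v, B 1 v = talg_counit v;
  skew1r : forall w, B w 1 = talg_counit w;
  skewMl : forall w1 w2 v,
    B (w1 * w2) v = tlift (fun a b => B w2 a * B w1 b : K^o) (talg_comul v);
  skewMr : forall w v1 v2,
    B w (v1 * v2) = tlift (fun a b => B a v1 * B b v2 : K^o) (talg_comul w)
}.

Variables L F : coalgType K.

Lemma skew_pairing_unique (B B' : talg L -> talg F -> K^o) :
  skew_pairing B -> skew_pairing B' ->
  (forall l f, B (tgen l) (tgen f) = B' (tgen l) (tgen f)) -> B =2 B'.
Proof.
move=> hB hB' Bgen.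
have [Bl Br] := skew_bilinear hB; have [Bl' Br'] := skew_bilinear hB'.
have hbm (D : talg L -> talg F -> K^o) v1 v2 : skew_pairing D ->
    bilinear_map (fun a b => D a v1 * D b v2 : K^o).
  by move=> hD; have [Dl _] := skew_bilinear hD;
    exact: bilinear_comp (@mul_bilinear _ K^o) (Dl v1) (Dl v2).
have lg := @tgen_linear K L.
(* The coproduct of a letter is a sum of pairs of letters, so [skewMr] never leaves the letters on
   the left; the induction on [v] must therefore hold for all [l]. *)
have genE l : B (tgen l) =1 B' (tgen l).
  apply: talg_ext => // v; elim: v l => [|f v ih] l.
    by rewrite tword_nil (skew1r hB) (skew1r hB').
  rewrite tword_cons (skewMr hB) (skewMr hB') talg_comul_gen.
  rewrite !tlift_tmap//; try exact: hbm.
  by apply: eq_tlift => a b; rewrite Bgen ih.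
move=> w v; move: w; apply: (@talg_ext _ _ _ (B^~ v) (B'^~ v)) => // w.
(* Here [v] stays general, since [skewMl] replaces it by the legs of its coproduct. *)
elim: w v => [|l w ih] v; first by rewrite tword_nil (skew1l hB) (skew1l hB').
rewrite tword_cons (skewMl hB) (skewMl hB').
by apply: eq_tlift => a b; rewrite ih genE.
Qed.

(** Swapping the arguments exchanges [skewMl] and [skewMr]; [trev] supplies the reversal that the
    new [skewMl] requires and cancels the one inherited by the new [skewMr]. *)
Lemma skew_pairing_trev (B : talg L -> talg F -> K^o) :
  skew_pairing B -> skew_pairing (fun v w => B (trev w) (trev v)).
Proof.
move=> hB; have [Bl Br] := skew_bilinear hB.
have [lrL lrF] := (@trev_linear K L, @trev_linear K F).
have mB := @mul_bilinear _ K^o.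
split=> [|w|v|v1 v2 w|v w1 w2].
- split=> [w|v]; [exact: linear_map_comp (Br _) lrF|exact: linear_map_comp (Bl _) lrL].
- by rewrite trev1 (skew1r hB) talg_counit_trev.
- by rewrite trev1 (skew1l hB) talg_counit_trev.
- rewrite trevM (skewMr hB) talg_comul_trev tlift_tmap//.
  exact: bilinear_comp mB (Bl _) (Bl _).
- rewrite trevM (skewMl hB) talg_comul_trev tlift_tmap//.
  exact: bilinear_comp mB (Br _) (Br _).
Qed.

End SkewPairing.

Section PairingOfMorphism.
Variables (K : fieldType) (L F : coalgType K) (x : {linear L -> invd F}).
Let lpi := pi_mor_linear x.
Let lpiv v : linear (fun w => pi_mor x w v).
Proof. by move=> k a b; rewrite lpi. Qed.

Lemma pi_mor_app1 (w : talg L) : pi_mor x w 1 = talg_counit w *: 1.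
Proof.
have le := @talg_counit_scalar K L.
move: w; apply: (@talg_ext _ _ _ (fun w => pi_mor x w 1)) => [||w] //.
  by move=> k a b; rewrite le scalerDl scalerA.
elim: w => [|l w ih]; first by rewrite tword_nil pi_mor1 invd1 talg_counit1 scale1r.
rewrite tword_cons pi_morM invdM ih (linear_mapZ (@invd_linear _ _ _)) pi_mor_gen ext_op1.
by rewrite scalerA talg_counitM talg_counit_gen mulrC.
Qed.

(** The rule [ext_opM] for letters passes to words because the coproduct of [talg L] is
    multiplicative, as [pi_mor] is. *)
Lemma pi_mor_appM (w : talg L) (v1 v2 : talg F) :
  pi_mor x w (v1 * v2) =
  tlift (fun a b => pi_mor x a v1 * pi_mor x b v2) (talg_comul w).
Proof.
have hb u1 u2 : bilinear_map (fun a b => pi_mor x a u1 * pi_mor x b u2).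
  exact: bilinear_comp (@mul_bilinear _ _) (lpiv u1) (lpiv u2).
move: w; apply: (@talg_ext _ _ _ (fun w => pi_mor x w (v1 * v2))) => [||w] //.
  exact: linear_map_comp (tlift_linear (hb _ _)) (@talg_comul_linear _ _).
have lg := @tgen_linear K L.
elim: w => [|l w ih].
  by rewrite tword_nil talg_comul1 [1 : talg L ⊗ talg L]/(pure 1 1) tlift_pure// pi_mor1 !invd1.
rewrite tword_cons pi_morM invdM ih talg_comulM tlift_mul//.
rewrite (tlift_comp _ (hb _ _) (@invd_linear _ _ _)); apply: eq_tlift => a b.
rewrite pi_mor_gen ext_opM talg_comul_gen tlift_tmap//.
  by apply: eq_tlift => l' l''; rewrite !pi_morM !pi_mor_gen.
have [ml _] := @mul_bilinear _ (talg L).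
exact: bilinear_comp (hb v1 v2) (ml a) (ml b).
Qed.

Lemma pi_mor_skew_pairing : skew_pairing (fun w v => ⟪pi_mor x w, v⟫ : K^o).
Proof.
have le : linear (@talg_counit K F : talg F -> K^o) := @talg_counit_scalar K F.
split=> [|v|w|w1 w2 v|w v1 v2].
- split=> [v|w]; last exact: pairing_scalarr.
  by move=> k a b; rewrite lpi pairing_scalarl.
- by rewrite pi_mor1.
- by rewrite /pairing pi_mor_app1 [LHS](linear_mapZ le) talg_counit1 [LHS]mulr1.
(* Right invariance enters through [invdE]. The operator of [w2] acts first and consumes the left
   leg of the coproduct of [v], leaving the right leg to [w1]; hence the reversed order. *)
- rewrite pi_morM /pairing invdM (invdE (pi_mor x w2)).
  have hb := scale_bilinear (talg F) (pairing_scalarr (pi_mor x w2)).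
  rewrite (tlift_comp _ hb (@invd_linear _ _ _)).
  have hb' : bilinear_map (fun a b => ⟪pi_mor x w2, a⟫ *: pi_mor x w1 b).
    exact: bilinear_comp hb (@linear_map_id _ _) (@invd_linear _ _ _).
  rewrite (@eq_tlift _ _ _ _ _ (fun a b => ⟪pi_mor x w2, a⟫ *: pi_mor x w1 b)).
    rewrite [LHS](tlift_comp _ hb' le); apply: eq_tlift => a b.
    exact: (linear_mapZ le).
  by move=> a b; rewrite (linear_mapZ (@invd_linear _ _ _)).
- rewrite /pairing pi_mor_appM.
  have hb : bilinear_map (fun a b => pi_mor x a v1 * pi_mor x b v2).
    exact: bilinear_comp (@mul_bilinear _ _) (lpiv v1) (lpiv v2).
  rewrite [LHS](tlift_comp _ hb le); apply: eq_tlift => a b.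
  exact: (talg_counitM (pi_mor x a v1) (pi_mor x b v2)).
Qed.

Lemma pairing_pi_mor_gen l f : ⟪pi_mor x (tgen l), tgen f⟫ = ⟪x l, f⟫.
Proof. by rewrite pi_mor_gen /pairing ext_op_gen; exact: talg_counit_gen. Qed.

End PairingOfMorphism.

Lemma pairing_pi_mor_transpose (K : fieldType) (L F : coalgType K)
    (x : {linear L -> invd F}) (w : talg L) (v : talg F) :
  ⟪pi_mor x w, v⟫ = ⟪pi_mor (transpose x) (trev v), trev w⟫.
Proof.
apply: (skew_pairing_unique (pi_mor_skew_pairing x)
  (skew_pairing_trev (pi_mor_skew_pairing (transpose x)))) => l f.
by rewrite !trev_gen !pairing_pi_mor_gen transposeP.
Qed.

Theorem mainTheorem1 (R : realType) (L F : finCoalgType R[i])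
    (x : {linear L -> invd F}) :
  (forall (ls : seq L) (fs : seq F),
     ⟪\prod_(l <- ls) ext_op x l, tword fs⟫ =
     ⟪\prod_(f <- rev fs) ext_op (transpose x) f, tword (rev ls)⟫) /\
  (forall (w : talg L) (v : talg F),
     ⟪pi_mor x w, v⟫ = ⟪pi_mor (transpose x) (trev v), trev w⟫).
Proof.
split=> [ls fs|w v]; last exact: pairing_pi_mor_transpose.
(* Both products of operators are values of [pi_mor] on words, so the first identity is the second
   one at [tword ls] and [tword fs]. Linearity is kept generic to serve both [x] and
   [transpose x]. *)
have lX (L' F' : coalgType R[i]) (z : {linear L' -> invd F'}) := ext_op_linear z.
rewrite -!(talg_mor_word (lX _ _ _)) -!trev_word.
exact: pairing_pi_mor_transpose.
Qed.
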